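(* Let $\Omega=B(0,1)\subset\mathbb{R}^2$, let $z(t)=(\cos t,\sin t)$, let $\varepsilon>0$, and set $$\alpha^\varepsilon(\cdot,t)=\frac{1}{\varepsilon^2}\chi_{B(z(t),\varepsilon)}.$$ Then $\alpha^\varepsilon$ is an exact weak solution of the two-dimensional semigeostrophic equations in dual variables with initial potential vorticity $\alpha^\varepsilon(\cdot,0)$.
   Context: $\chi_{B(z,\varepsilon)}$ is the indicator function of the disk of center $z$ and radius $\varepsilon$; $\chi_\Omega$ also denotes Lebesgue measure on $\Omega$; $G\#\mu$ is the pushforward of $\mu$ by $G$; $(a,b)^\perp=(-b,a)$. The semigeostrophic equations in dual variables (with the vertical variable ignored) on a bounded domain $\Omega\subset\mathbb{R}^2$ are $$\partial_t\alpha+\nabla\cdot(U\alpha)=0,\qquad U(X,t)=[X-\nabla P^*(X,t)]^\perp,\qquad \nabla P(\cdot,t)\#\chi_\Omega=\alpha(\cdot,t),\qquad \alpha(\cdot,0)=\alpha_0,$$ where $P(\cdot,t)$ is convex on $\Omega$ for each $t$ and $P^*(X,t)=\sup_{x\in\Omega}\{x\cdot X-P(x,t)\}$, $X\in\mathbb{R}^2$. A function $\alpha$ is a weak solution with initial potential vorticity $\alpha_0$ if there is such a $P$ with $\nabla P(\cdot,t)\#\chi_\Omega=\alpha(\cdot,t)$ for all $t$ and, for every $T>0$ and every $\phi\in C^1_c(\mathbb{R}^2\times[0,T))$, $$\int_{\mathbb{R}^2\times[0,T)}[\partial_t\phi+U\cdot\nabla\phi]\,\alpha\,dX\,dt+\int_{\mathbb{R}^2}\alpha_0(X)\phi(X,0)\,dX=0.$$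 *)

(* Defs.v *)
From HB Require Import structures.
From mathcomp Require Import all_boot all_order all_algebra.
From mathcomp Require Import all_classical all_reals all_analysis.
Import Order.TTheory GRing.Theory Num.Theory numFieldNormedType.Exports.

Set Implicit Arguments.
Unset Strict Implicit.
Unset Printing Implicit Defensive.

Local Open Scope classical_set_scope.
Local Open Scope ring_scope.

(* Points of the plane are pairs X : R * R, and points (X, t) of space-time are
   pairs p : R * R * R with p.1 = X and p.2 = t. *)

Notation leb2 := (lebesgue_measure \x lebesgue_measure)%E.
Notation leb3 := (leb2 \x lebesgue_measure)%E.

Section Plane.
Context {R : realType}.

Definition dot (X Y : R * R) : R := X.1 * Y.1 + X.2 * Y.2.

Definition perp (X : R * R) : R * R := (- X.2, X.1).

(* The library's norm on R * R is the sup norm, whose balls are squares. *)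
Definition enorm (X : R * R) : R := Num.sqrt (dot X X).

Definition disk (z : R * R) (r : R) : set (R * R) := [set X | enorm (X - z) < r].

(* For convex f this is the gradient at almost every point; elsewhere the
   partial derivatives have unspecified values. *)
Definition grad (f : R * R -> R) (X : R * R) : R * R :=
  ('D_((1, 0) : R * R) f X, 'D_((0, 1) : R * R) f X).

(* The supremum is finite when P is convex on a nonempty bounded domain Omega. *)
Definition legendre (Omega : set (R * R)) (P : R * R -> R) (X : R * R) : R :=
  sup [set dot x X - P x | x in Omega].

(* G # chi_Omega = a, where the function a stands for the measure a(X) dX. *)
Definition pushes_to (Omega : set (R * R)) (G : R * R -> R * R)
    (a : R * R -> R) : Prop :=
  [/\ measurable_fun Omega G,
      measurable_fun setT a &
      forall A : set (R * R), measurable A ->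
        pushforward (fun B => leb2 (B `&` Omega)) G A
        = (\int[leb2]_(X in A) (a X)%:E)%E ].

End Plane.

Section TestFunctions.
Context {R : realType}.

Definition slab (T : R) : set (R * R * R) := [set p | 0 <= p.2 < T].

Definition dt_quot (phi : R * R * R -> R) (p : R * R * R) (h : R) : R :=
  h^-1 * (phi (p.1, p.2 + h) - phi p).

(* Right-hand time derivative, so that only times t >= 0 matter, also at t = 0;
   it agrees with the two-sided derivative wherever the latter exists. *)
Definition dt (phi : R * R * R -> R) (p : R * R * R) : R :=
  lim (dt_quot phi p h @[h --> 0^'+]).

Definition slice (phi : R * R * R -> R) (t : R) : R * R -> R :=
  fun X => phi (X, t).

Definition dX (phi : R * R * R -> R) (p : R * R * R) : R * R :=
  grad (slice phi p.2) p.1.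

(* C^1 on R^2 x [0, T): differentiable for 0 < t < T, with first derivatives
   that exist (one-sided in time) and are continuous up to t = 0. *)
Definition C1_slab (T : R) (phi : R * R * R -> R) : Prop :=
  [/\ {within slab T, continuous phi},
      forall p, 0 < p.2 < T -> differentiable phi p,
      forall p, slab T p ->
        [/\ cvg (dt_quot phi p h @[h --> 0^'+]),
            derivable (slice phi p.2) p.1 ((1, 0) : R * R) &
            derivable (slice phi p.2) p.1 ((0, 1) : R * R)],
      {within slab T, continuous (dt phi)} &
      {within slab T, continuous (dX phi)} ].

(* The compact support may meet t = 0 but not t = T.  The values of phi outside
   slab T are irrelevant. *)
Definition C1c_slab (T : R) (phi : R * R * R -> R) : Prop :=
  C1_slab T phi /\
  exists K : set (R * R * R),
    [/\ compact K, K `<=` slab T & forall p, slab T p -> ~ K p -> phi p = 0].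

End TestFunctions.

Section Semigeostrophic.
Context {R : realType}.

Definition velocity (Omega : set (R * R)) (P : R -> R * R -> R)
    (X : R * R) (t : R) : R * R :=
  perp (X - grad (legendre Omega (P t)) X).

Definition weak_integrand (U : R * R -> R -> R * R) (alpha : R -> R * R -> R)
    (phi : R * R * R -> R) (p : R * R * R) : R :=
  (dt phi p + dot (U p.1 p.2) (dX phi p)) * alpha p.2 p.1.

(* Integrability is part of the definition, so that both integrals below are
   meaningful. *)
Definition weak_solution (Omega : set (R * R)) (alpha : R -> R * R -> R)
    (alpha0 : R * R -> R) : Prop :=
  exists P : R -> R * R -> R,
    (forall t, 0 <= t ->
       convex_function Omega (P t) /\
       pushes_to Omega (grad (P t)) (alpha t)) /\
    (forall (T : R) (phi : R * R * R -> R), 0 < T -> C1c_slab T phi ->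
       let F := weak_integrand (velocity Omega P) alpha phi in
       let F0 := fun X => alpha0 X * phi (X, 0) in
       [/\ leb3.-integrable (slab T) (EFin \o F),
           leb2.-integrable setT (EFin \o F0) &
           (\int[leb3]_(p in slab T) (F p)%:E
            + \int[leb2]_(X in setT) (F0 X)%:E = 0)%E ]).

Definition alpha_disk (eps t : R) (X : R * R) : R :=
  (eps ^+ 2)^-1 * \1_(disk (cos t, sin t) eps) X.

End Semigeostrophic.

(* Main.v *)
From HB Require Import structures.
Require Import Defs.
From mathcomp Require Import all_boot all_order all_algebra.
From mathcomp Require Import all_classical all_reals all_analysis measurable_realfun.
From mathcomp Require Import ring lra.
Import Order.TTheory GRing.Theory Num.Theory numFieldNormedType.Exports.
Local Open Scope classical_set_scope.
Local Open Scope ring_scope.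

(** Write z(t) for the unit-speed point (cos t, sin t) of the unit circle.

    The pressure is P(x,t) = (eps/2)|x|^2 + z(t).x.  It is convex, and its
    gradient x |-> eps x + z(t) is a similarity of ratio eps which carries the
    unit disk onto B(z(t),eps) and divides the Lebesgue density by eps^2; this
    is the transport condition [pushes_to_potential].

    For X in B(z(t),eps) the supremum that defines P* is attained at the point
    (X - z(t))/eps of the unit disk, so P*(X,t) = |X - z(t)|^2/(2 eps) there and
    grad P*(X,t) = (X - z(t))/eps ([grad_legendre_potential]).  The potential
    vorticity vanishes outside of this disk, hence only there does the
    velocity U matter.  With W = X - z(t),
      U = z(t)^perp + (1 - 1/eps) W^perp,
    the sum of the velocity z' = z^perp of the centre and of a rigid rotation
    about it with angular speed c = (eps - 1)/eps.  The characteristics are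
    therefore explicit: X(t) = z(t) + eps R(ct) Y, where R(s) is the rotation of
    angle s and the label Y runs over the unit disk.

    For each t, the map Y |-> X(t) is a similarity of ratio eps, and so
    multiplies areas by eps^2 and turns the unit disk into B(z(t),eps).  In the
    variables (Y,t) the space-time integral of the weak formulation becomes,
    by Fubini's theorem, the integral over the unit disk of
      int_0^T (d/dt) phi(X(t),t) dt = - phi(X(0),0),
    since the derivative of phi along a characteristic is
    d_t phi + U.grad phi ([integral_material_derivative]) and phi vanishes near
    time T.  Returning to the variable X at time 0 gives minus the integral of
    alpha_0 phi(.,0) ([weak_formulation]).

    The change of variables rests on the behaviour of planar Lebesgue measure
    under similarities ([leb2_similarity]), obtained by factoring them into
    shears, whose effect is read off one-dimensional sections. *)

(** * Lebesgue measure under similarities of the plane *)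

Lemma lebesgue_measure_affine {R : realType} (k b : R) (A : set R) :
  k != 0 -> measurable A ->
  lebesgue_measure ((fun y => k * y + b) @^-1` A)
  = ((`|k|^-1)%:E * lebesgue_measure A)%E.
Proof.
wlog k0 : k A / 0 < k => [H k_neq0 mA|_ mA].
  have [/H|k_lt0|k_eq0] := ltgtP 0 k; [exact|idtac|by rewrite -k_eq0 eqxx in k_neq0].
  rewrite -normrN -(H (- k)) ?oppr_gt0 ?oppr_eq0//.
  rewrite -[RHS]lebesgue_measureN.
    rewrite /pushforward; congr lebesgue_measure.
    by apply/seteqP; split=> y /=; rewrite mulrNN.
  rewrite -[X in measurable X]setTI.
  by have : measurable_fun setT (fun y : R => - k * y + b);
    [exact: measurable_funD|exact].
have mf : measurable_fun setT (fun y : measurableTypeR R => (k * y + b : measurableTypeR R)).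
  exact: measurable_funD.
have k_ge0 : 0 <= k by exact: ltW.
pose m : {measure set (measurableTypeR R) -> \bar R} :=
  mscale (NngNum k_ge0) (pushforward lebesgue_measure
    (fun y : measurableTypeR R => k * y + b : measurableTypeR R)).
have mE : lebesgue_measure A = m mf A.
  apply: lebesgue_measure_unique => //= _ [[u v] _ <-] /=.
  rewrite /m/= /mscale/= /pushforward/=.
  have -> : (fun y : R => k * y + b) @^-1` `]u, v] = `](u - b) / k, (v - b) / k]%classic.
    apply/seteqP; split=> y /=; rewrite !in_itv/= ltr_pdivrMr// ler_pdivlMr//;
     by move=> /andP[? ?]; apply/andP; split; lra.
  rewrite !lebesgue_measure_itv/= !lte_fin ltr_pM2r ?invr_gt0// ltrD2r.
  case: ifPn => _; last by rewrite mule0.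
  rewrite -!EFinB -EFinM; congr EFin; field.
  by rewrite gt_eqF.
rewrite mE gtr0_norm//.
change (m mf A) with (k%:E * lebesgue_measure ((fun y : R => k * y + b)%R @^-1` A))%E.
by rewrite muleA -EFinM mulVf ?gt_eqF// mul1e.
Qed.

Section PlaneMeasure.
Context {R : realType}.

Definition shear (k a b : R) (X : R * R) : R * R := (X.1, k * X.2 + (a * X.1 + b)).
Definition swap_coord (X : R * R) : R * R := (X.2, X.1).

(** Each vertical section undergoes a one-dimensional affine map of ratio k. *)
Lemma leb2_shear (k a b : R) (A : set (R * R)) : k != 0 -> measurable A ->
  leb2 (shear k a b @^-1` A) = ((`|k|^-1)%:E * leb2 A)%E.
Proof.
move=> k_neq0 mA.
transitivity (\int[lebesgue_measure]_(x in [set: R])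
    ((`|k|^-1)%:E * (lebesgue_measure \o xsection A) x))%E.
  apply: eq_integral => x _ /=.
  rewrite -(lebesgue_measure_affine k (a * x + b))//; last exact: measurable_xsection.
rewrite ge0_integralZl//.
  by apply: measurable_fun_xsection; rewrite ?inE.
Qed.

Lemma leb2_swap (A : set (R * R)) : measurable A ->
  leb2 (swap_coord @^-1` A) = leb2 A.
Proof.
move=> mA.
have msw : measurable_fun setT (fun X : measurableTypeR R * measurableTypeR R => (X.2, X.1)).
  exact: measurable_swap.
pose m : {measure set (measurableTypeR R * measurableTypeR R) -> \bar R} :=
  pushforward leb2 (fun X : measurableTypeR R * measurableTypeR R => (X.2, X.1)).
rewrite [RHS](@product_measure_unique _ _ _ _ _ _ _ (m msw))// => B C mB mC.
rewrite /m/= /pushforward.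
rewrite (_ : _ @^-1` _ = C `*` B); last first.
  by apply/seteqP; split=> -[x y] [].
by rewrite product_measure1E// muleC.
Qed.

Lemma measurable_preimage_shear k a b {A : set (R * R)} :
  measurable A -> measurable (shear k a b @^-1` A).
Proof.
move=> mA; rewrite -[X in measurable X]setTI.
suff : measurable_fun setT (shear k a b) by exact.
apply: measurable_fun_pair => //; apply: measurable_funD.
  exact: measurable_funM.
by apply: measurable_funD => //; exact: measurable_funM.
Qed.

Lemma measurable_preimage_swap {A : set (R * R)} :
  measurable A -> measurable (swap_coord @^-1` A).
Proof.
move=> mA; rewrite -[X in measurable X]setTI.
suff : measurable_fun setT swap_coord by exact.
exact: measurable_fun_pair.
Qed.

(** In complex notation, Y |-> z + (p + iq) Y. *)
Definition similarity (p q : R) (z Y : R * R) : R * R :=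
  z + (p * Y.1 - q * Y.2, q * Y.1 + p * Y.2).

(** A direct similarity alters one coordinate at a time, so it is a composite
    of scaled shears and coordinate exchanges; the measure of a preimage is then
    multiplied by the inverse of the product of the scaling factors. *)
Lemma leb2_similarity (p q : R) (z : R * R) (A : set (R * R)) :
  p ^+ 2 + q ^+ 2 != 0 -> measurable A ->
  leb2 (similarity p q z @^-1` A)
  = (((p ^+ 2 + q ^+ 2)^-1)%:E * leb2 A)%E.
Proof.
move=> pq mA; rewrite /similarity.
(* With a zero diagonal each new coordinate is an affine function of the other
   old one: both are rescaled in turn, then exchanged. *)
have [p0|p0] := eqVneq p 0.
  have q0 : q != 0 by move: pq; rewrite p0 expr0n add0r sqrf_eq0.
  rewrite (_ : (fun _ => _) = swap_coord \o (shear (- q) 0 z.1 \o (swap_coord \o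
    (shear q 0 z.2 \o swap_coord)))); last first.
    apply/funext => X; rewrite p0 /shear/swap_coord/=; congr (_, _) => /=; ring.
  rewrite !comp_preimage.
  have mB := measurable_preimage_swap mA.
  have mC := measurable_preimage_shear (- q) 0 z.1 mB.
  have mD := measurable_preimage_swap mC.
  have mE := measurable_preimage_shear q 0 z.2 mD.
  rewrite leb2_swap// leb2_shear// leb2_swap// leb2_shear ?oppr_eq0// leb2_swap//.
  rewrite muleA -EFinM; congr (_%:E * _)%E.
  by rewrite p0 expr0n add0r normrN -invfM -normrM -expr2 ger0_norm ?sqr_ge0.
(* The first coordinate becomes x' = p x - q y + z.1; the second shear writes
   the new second coordinate in terms of x' and y, whence the factor
   (p^2 + q^2)/p of y. *)
rewrite (_ : (fun _ => _) =
    shear ((p ^+ 2 + q ^+ 2) / p) (q / p) (z.2 - q / p * z.1) \o (swap_coord \o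
    (shear p (- q) z.1 \o swap_coord))); last first.
  by apply/funext => X; rewrite /shear/swap_coord/=; congr (_, _) => /=; field.
rewrite !comp_preimage.
have mB := measurable_preimage_shear ((p ^+ 2 + q ^+ 2) / p) (q / p) (z.2 - q / p * z.1) mA.
have mC := measurable_preimage_swap mB.
have mD := measurable_preimage_shear p (- q) z.1 mC.
rewrite leb2_swap// leb2_shear// leb2_swap// leb2_shear ?mulf_neq0 ?invr_eq0//.
rewrite muleA -EFinM; congr (_%:E * _)%E.
rewrite -invfM -normrM mulrCA divff// mulr1 ger0_norm// addr_ge0// sqr_ge0//.
Qed.

End PlaneMeasure.

Lemma lebesgue_measure_segment_fin {R : realType} (a b : R) :
  (lebesgue_measure (`[a, b]%classic : set R) < +oo)%E.
Proof.
by rewrite lebesgue_measure_itv/=; case: ifP => _; rewrite ?ltry// -EFinB ltry.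
Qed.

Lemma sigma_finite_leb2 (R : realType) :
  sigma_finite setT (leb2 : set (measurableTypeR R * measurableTypeR R) -> \bar R).
Proof.
pose F n : set R := `[- n%:R, n%:R]%classic.
have mF n : measurable (F n) by exact: measurable_itv.
exists (fun n => F n `*` F n).
  apply/esym/seteqP; split=> // -[x y] _.
  exists (Num.truncn (Num.max `|x| `|y|)).+1 => //.
  by split; rewrite /F /= in_itv/= -ler_norml ltW//;
    rewrite (le_lt_trans _ (truncnS_gt _))// le_max lexx ?orbT.
move=> n; split; first by apply: measurableX; exact: measurable_itv.
have lF : (lebesgue_measure (F n) < +oo)%E := lebesgue_measure_segment_fin _ _.
rewrite product_measure1E; [|exact: mF|exact: mF].
by apply: lte_mul_pinfty; rewrite // ge0_fin_numE.
Qed.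

(** Planar Lebesgue measure together with its sigma-finiteness, on which rest
    Fubini's theorem in space-time and the slicing of space-time volumes by
    time. *)
Definition plane_measure {R : realType} :
  set (measurableTypeR R * measurableTypeR R) -> \bar R := leb2.
HB.instance Definition _ (R : realType) := Measure.on (@plane_measure R).
HB.instance Definition _ (R : realType) :=
  Measure_isSigmaFinite.Build _ _ _ (@plane_measure R) (@sigma_finite_leb2 R).

(** * The pressure, its gradient and its Legendre transform *)

Section Potentials.
Context {R : realType}.
Implicit Types (X Y z v : R * R) (f : R * R -> R).

(** The gradients of the potential, of its Legendre transform and of a test
    function off its support are read off quadratic expansions; these need only
    be local, as the Legendre transform is quadratic on a disk only. *)
Lemma derive_quadratic f X v (c d : R) :
  (\forall h \near (0 : R), f (h *: v + X) = f X + h * c + h ^+ 2 * d) ->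
  'D_v f X = c.
Proof.
move=> fE; rewrite /derive; apply/cvg_lim => //.
suff : (fun h : R => c + h * d) @ 0^' --> c.
  apply: cvg_trans; apply: near_eq_cvg.
  near=> h; have h0 : h != 0 by near: h; exact: nbhs_dnbhs_neq.
  have fh : f (h *: v + X) = f X + h * c + h ^+ 2 * d.
    by near: h; exact: nbhs_dnbhs.
  by rewrite /= fh /GRing.scale/=; field.
rewrite -[X in _ --> X]addr0; apply: cvgD; first exact: cvg_cst.
rewrite -[X in _ --> X](mul0r d); apply: cvgM; last exact: cvg_cst.
exact: nbhs_dnbhs.
Unshelve. all: by end_near. Qed.

Lemma diskE z r : 0 < r -> disk z r = [set X | dot (X - z) (X - z) < r ^+ 2].
Proof.
move=> r0; apply/funext => X; rewrite /disk/= /enorm.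
by rewrite -{1}(gtr0_norm r0) -sqrtr_sqr ltr_sqrt ?exprn_gt0.
Qed.

Lemma measurable_disk z r : 0 < r -> measurable (disk z r).
Proof.
move=> r0; rewrite diskE// -[X in measurable X]setTI.
apply: measurable_fun_ltr => //=; rewrite /dot/=.
by apply: measurable_funD; apply: measurable_funM; apply: measurable_funB.
Qed.

Lemma disk_similarity (eps p q : R) z : 0 < eps -> p ^+ 2 + q ^+ 2 = eps ^+ 2 ->
  similarity p q z @^-1` disk z eps = disk (0, 0) 1.
Proof.
move=> eps0 pq; rewrite !diskE//; apply/funext => Y /=; congr is_true.
rewrite -(ltr_pM2l (exprn_gt0 2 eps0) (dot (Y - _) _)) expr1n mulr1 -pq.
by congr (_ < _); rewrite /similarity /dot/=; ring.
Qed.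

Definition potential (eps : R) z X : R := eps / 2 * dot X X + dot z X.

(** The convexity defect is (eps/2) s (1 - s) |x - y|^2. *)
Lemma convex_potential eps z : 0 < eps ->
  convex_function (disk (0, 0) 1) (potential eps z).
Proof.
move=> eps0 t x y _ _.
rewrite -[leRHS]/(t%:num * potential eps z x + (1 - t%:num) * potential eps z y).
rewrite /conv/= /potential /dot /unstable.onem /= /GRing.scale/=.
have /andP[] : (0 <= t%:num <= 1) by rewrite ge0 le1.
set s := t%:num => s0 s1; rewrite -subr_ge0.
rewrite (_ : _ - _ = eps / 2 * (s * (1 - s))
  * ((x.1 - y.1) ^+ 2 + (x.2 - y.2) ^+ 2)); last by field.
rewrite mulr_ge0 ?addr_ge0 ?sqr_ge0// mulr_ge0 ?mulr_ge0 ?subr_ge0//.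
exact: ltW.
Qed.

Lemma grad_potential eps z : grad (potential eps z) = fun X => eps *: X + z.
Proof.
apply/funext => X; rewrite /grad /=.
rewrite (@derive_quadratic _ _ _ (eps * X.1 + z.1) (eps / 2)); last first.
  by near=> h; rewrite /potential/dot/= /GRing.scale/=; field.
rewrite (@derive_quadratic _ _ _ (eps * X.2 + z.2) (eps / 2)); last first.
  by near=> h; rewrite /potential/dot/= /GRing.scale/=; field.
done.
Unshelve. all: by end_near. Qed.

(** Completing the square, x.X - P(x) = |X-z|^2/(2 eps) - (eps/2)|x - x0|^2 with
    x0 = (X - z)/eps, and x0 lies in the unit disk exactly because X lies in the
    disk of radius eps about z. *)
Lemma legendre_potential eps z X : 0 < eps -> disk z eps X ->
  legendre (disk (0, 0) 1) (potential eps z) X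
  = dot (X - z) (X - z) / (2 * eps).
Proof.
move=> eps0 DX; have epsn0 : eps != 0 by rewrite gt_eqF.
pose x0 := eps^-1 *: (X - z).
have Dx0 : disk (0, 0) 1 x0.
  move: DX; rewrite !diskE//= /x0 /dot/= /GRing.scale/= !subr0 => DX.
  rewrite -(ltr_pM2l (exprn_gt0 2 eps0)) expr1n mulr1.
  by apply: le_lt_trans DX; rewrite le_eqVlt; apply/orP; left; apply/eqP; field.
have valE x : dot x X - potential eps z x = dot (X - z) (X - z) / (2 * eps)
    - eps / 2 * dot (x - x0) (x - x0).
  by rewrite /potential /dot /x0/= /GRing.scale/=; field.
have dot_ge0 Y : 0 <= dot Y Y by rewrite addr_ge0 ?sqr_ge0// -expr2 sqr_ge0.
have ubd : ubound [set dot x X - potential eps z x | x in disk (0, 0) 1]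
    (dot (X - z) (X - z) / (2 * eps)).
  move=> _ [x _ <-]; rewrite valE gerBl mulr_ge0// divr_ge0// ltW//.
apply/eqP; rewrite eq_le; apply/andP; split.
  apply: ge_sup => //; by exists (dot x0 X - potential eps z x0), x0.
apply: ub_le_sup; first by exists (dot (X - z) (X - z) / (2 * eps)).
by exists x0 => //; rewrite valE subrr /dot/= !mul0r addr0 mulr0 subr0.
Qed.

Lemma grad_legendre_potential eps z X : 0 < eps -> disk z eps X ->
  grad (legendre (disk (0, 0) 1) (potential eps z)) X = eps^-1 *: (X - z).
Proof.
move=> eps0 DX; have epsn0 : eps != 0 by rewrite gt_eqF.
have near_disk v : \forall h \near (0 : R), disk z eps (h *: v + X).
  rewrite diskE//=.
  have : (fun h : R => dot (h *: v + X - z) (h *: v + X - z)) @ (0 : R)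
      --> dot (X - z) (X - z).
    rewrite (_ : (fun _ => _) = fun h => dot (X - z) (X - z)
       + h * (2 * dot v (X - z) + h * dot v v)); last first.
      by apply/funext => h; rewrite /dot/= /GRing.scale/=; ring.
    rewrite -[X in _ --> X]addr0; apply: cvgD; first exact: cvg_cst.
    rewrite -[X in _ --> X](mul0r (2 * dot v (X - z) + 0 * dot v v)).
    apply: cvgM; first exact: cvg_id.
    apply: cvgD; first exact: cvg_cst.
    by apply: cvgM; [exact: cvg_id|exact: cvg_cst].
  move/cvgr_lt; apply.
  by move: DX; rewrite diskE.
rewrite /grad; congr (_, _).
  apply: (@derive_quadratic _ _ _ _ (2 * eps)^-1); near=> h.
  rewrite !legendre_potential//; last by near: h; exact: near_disk.
  by rewrite /dot/= /GRing.scale/=; field.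
apply: (@derive_quadratic _ _ _ _ (2 * eps)^-1); near=> h.
rewrite !legendre_potential//; last by near: h; exact: near_disk.
by rewrite /dot/= /GRing.scale/=; field.
Unshelve. all: by end_near. Qed.

(** The gradient of the potential is the similarity of ratio eps and angle 0,
    and it pulls the disk of radius eps about z back to the unit disk. *)
Lemma pushes_to_potential eps z : 0 < eps ->
  pushes_to (disk (0, 0) 1) (grad (potential eps z))
    (fun X => (eps ^+ 2)^-1 * \1_(disk z eps) X).
Proof.
move=> eps0; have epsn0 : eps != 0 by rewrite gt_eqF.
have mD := measurable_disk z _ eps0.
rewrite grad_potential; split.
- apply: measurable_funTS; apply: measurable_fun_pair => /=;
  by apply: measurable_funD => //; apply: measurable_funM.
- apply: measurable_funM => //; exact: measurable_indic.
move=> A mA; rewrite /pushforward.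
transitivity (leb2 (similarity eps 0 z @^-1` (A `&` disk z eps))).
  rewrite (_ : (fun _ => _) = similarity eps 0 z).
    by rewrite preimage_setI disk_similarity// ?expr0n ?addr0.
  by apply/funext => X; rewrite /similarity !mul0r subr0 add0r addrC.
have e2 : eps ^+ 2 + 0 ^+ 2 = eps ^+ 2 by rewrite expr0n addr0.
rewrite leb2_similarity ?e2 ?sqrf_eq0//; last exact: measurableI.
under eq_integral do rewrite EFinM.
rewrite ge0_integralZl//; last 2 first.
  by apply/measurable_EFinP; exact: measurable_indic.
  by rewrite lee_fin invr_ge0 sqr_ge0.
by rewrite integral_indic// setIC.
Qed.

End Potentials.

(** * Change of variables for maps that scale a measure *)

Section ScalingMaps.
Context d (T : measurableType d) (R : realType).
Variables (mu : {measure set T -> \bar R}) (phi : T -> T) (k : R).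
Hypotheses (mphi : measurable_fun setT phi) (k_gt0 : 0 < k)
  (scale_phi : forall A, measurable A -> mu (phi @^-1` A) = (k%:E * mu A)%E).
Implicit Types f : T -> \bar R.

Lemma ge0_integral_scaling f : measurable_fun setT f ->
  (forall x, 0 <= f x)%E ->
  (\int[mu]_x f (phi x) = k%:E * \int[mu]_x f x)%E.
Proof.
move=> mf f0; have k_ge0 := ltW k_gt0.
have := @ge0_integral_pushforward _ _ _ _ _ _ mphi mu setT f.
rewrite preimage_setT => <-//.
rewrite -(ge0_integral_mscale mu measurableT (NngNum k_ge0))//.
by apply: eq_measure_integral => A mA _; rewrite -[LHS]/(mu (phi @^-1` A)) scale_phi.
Qed.

Lemma integrable_scaling f : mu.-integrable setT f ->
  mu.-integrable setT (f \o phi).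
Proof.
move=> /integrableP[mf fi]; apply/integrableP; split.
  exact: measurableT_comp.
rewrite (ge0_integral_scaling (abse \o f))//.
- by rewrite lte_mul_pinfty// lee_fin ltW.
- exact: measurableT_comp.
- by move=> x /=.
Qed.

Lemma integral_scaling f : mu.-integrable setT f ->
  (\int[mu]_x f (phi x) = k%:E * \int[mu]_x f x)%E.
Proof.
move=> fi; have mf := measurable_int mu fi.
rewrite (integralE _ _ (f \o phi)) funepos_comp funeneg_comp.
rewrite (ge0_integral_scaling (f^\+)%E)//; last exact: measurable_funepos.
rewrite (ge0_integral_scaling (f^\-)%E)//; last exact: measurable_funeneg.
rewrite [in RHS]integralE [RHS]muleBr// fin_num_adde_defr//.
exact: integrable_pos_fin_num.
Qed.

End ScalingMaps.

(** Slice by the second coordinate, which phi preserves: every slice is scaled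
    by k, hence so is the product measure. *)
Lemma product_measure_fiberwise_scaling d1 d2 (T1 : measurableType d1)
    (T2 : measurableType d2) (R : realType)
    (m1 : {sigma_finite_measure set T1 -> \bar R})
    (m2 : {sigma_finite_measure set T2 -> \bar R})
    (phi : T1 * T2 -> T1 * T2) (k : R) (A : set (T1 * T2)) :
  measurable_fun setT phi -> (forall q, (phi q).2 = q.2) -> 0 <= k ->
  (forall y B, measurable B ->
     m1 ((fun x => (phi (x, y)).1) @^-1` B) = (k%:E * m1 B)%E) ->
  measurable A -> ((m1 \x m2) (phi @^-1` A) = k%:E * (m1 \x m2) A)%E.
Proof.
move=> mphi phi2 k_ge0 scale_phi mA.
have E B : measurable B -> ((m1 \x m2) B = (m1 \x^ m2) B)%E.
  move=> mB; apply: product_measure_unique => // C D mC mD.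
  exact: product_measure2E.
have mpA : measurable (phi @^-1` A) by rewrite -[X in measurable X]setTI; exact: mphi.
rewrite !E// /product_measure2 -ge0_integralZl//; last first.
  by apply: measurable_fun_ysection; rewrite ?inE.
apply: eq_integral => y _ /=; rewrite -(scale_phi y); last exact: measurable_ysection.
congr (m1 _); apply/seteqP; split=> x; rewrite /ysection/= !inE/= => h;
  by move: h; rewrite [phi _]surjective_pairing phi2.
Qed.

(** * The flow of the semigeostrophic velocity *)

Section Flow.
Context {R : realType}.
Variables (eps : R) (eps_gt0 : 0 < eps).

Definition orbit_center (t : R) : R * R := (cos t, sin t).

(** The angular speed of the velocity field about the moving centre. *)
Definition spin : R := (eps - 1) / eps.

(** The characteristic with label Y, which is not its position at time 0: that
    position is orbit_center 0 + eps Y.  The labels of the vortex fill the unit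
    disk at all times. *)
Definition trajectory (t : R) (Y : R * R) : R * R :=
  similarity (eps * cos (spin * t)) (eps * sin (spin * t)) (orbit_center t) Y.

Definition flow (q : R * R * R) : R * R * R := (trajectory q.2 q.1, q.2).

Lemma spin_radius t : (eps * cos (spin * t)) ^+ 2 + (eps * sin (spin * t)) ^+ 2 = eps ^+ 2.
Proof. by rewrite !exprMn -mulrDr cos2Dsin2 mulr1. Qed.

Lemma leb2_trajectory t (A : set (R * R)) : measurable A ->
  leb2 (trajectory t @^-1` A) = (((eps ^+ 2)^-1)%:E * leb2 A)%E.
Proof.
move=> mA; rewrite leb2_similarity ?spin_radius//.
by rewrite sqrf_eq0 gt_eqF.
Qed.

Lemma measurable_trajectory t : measurable_fun setT (trajectory t).
Proof.
apply: measurable_fun_pair => /=; apply: measurable_funD => //.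
  by apply: measurable_funB; apply: measurable_funM.
by apply: measurable_funD; apply: measurable_funM.
Qed.

Lemma measurable_flow : measurable_fun setT flow.
Proof.
have mt : measurable_fun setT (fun q : R * R * R => q.2) by exact: measurable_snd.
have mspin : measurable_fun setT (fun q : R * R * R => spin * q.2).
  exact: measurable_funM.
have mc (g : R * R * R -> R) : measurable_fun setT g ->
    measurable_fun setT (fun q => cos (g q)).
  apply: measurableT_comp.
  by apply: continuous_measurable_fun; exact: continuous_cos.
have ms (g : R * R * R -> R) : measurable_fun setT g ->
    measurable_fun setT (fun q => sin (g q)).
  apply: measurableT_comp.
  by apply: continuous_measurable_fun; exact: continuous_sin.
have := mc _ mt; have := ms _ mt; have := mc _ mspin; have := ms _ mspin.
move=> ms1 mc1 ms2 mc2.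
have m1 : measurable_fun setT (fun q : R * R * R => q.1.1).
  by apply: measurableT_comp.
have m2 : measurable_fun setT (fun q : R * R * R => q.1.2).
  by apply: measurableT_comp.
apply: measurable_fun_pair => //; apply: measurable_fun_pair => /=.
  apply: measurable_funD => //; apply: measurable_funB.
    by apply: measurable_funM => //; apply: measurable_funM.
  by apply: measurable_funM => //; apply: measurable_funM.
apply: measurable_funD => //; apply: measurable_funD.
  by apply: measurable_funM => //; apply: measurable_funM.
by apply: measurable_funM => //; apply: measurable_funM.
Qed.

Lemma leb3_flow (A : set (R * R * R)) : measurable A ->
  leb3 (flow @^-1` A) = (((eps ^+ 2)^-1)%:E * leb3 A)%E.
Proof.
move=> mA.
apply: (@product_measure_fiberwise_scaling _ _
  (measurableTypeR R * measurableTypeR R)%type (measurableTypeR R) R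
  plane_measure lebesgue_measure flow ((eps ^+ 2)^-1) A).
- exact: measurable_flow.
- by [].
- by rewrite invr_ge0 sqr_ge0.
- by move=> t B mB; exact: leb2_trajectory.
- by [].
Qed.

End Flow.

(** * Borel sets of space-time *)

Section SpaceTimeMeasurability.
Context {R : realType}.

(** The boxes with rational centres and radii 1/(n+1) form a countable base of
    the product topology, made of measurable rectangles. *)
Lemma open_measurable3 (U : set (R * R * R)) : open U -> measurable U.
Proof.
move=> oU.
pose box (i : rat * rat * rat * nat) : set (R * R * R) :=
  ball ((ratr i.1.1.1, ratr i.1.1.2, ratr i.1.2) : R * R * R) (i.2.+1%:R^-1 : R).
pose F i := if `[< box i `<=` U >] then box i else set0.
have -> : U = \bigcup_i F i.
  apply/seteqP; split; last first.
    by move=> p [i _]; rewrite /F; case: asboolP => // sub /sub.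
  move=> p Up.
  have /nbhs_ballP[e /= e0 eU] : nbhs p U by exact: open_nbhs_nbhs.
  have [n ne] : exists n : nat, (n.+1%:R^-1 : R) < e / 2.
    exists (Num.truncn (e / 2)^-1); rewrite invf_plt ?posrE ?divr_gt0//.
    exact: truncnS_gt.
  have n0 : 0 < (n.+1%:R^-1 : R) by rewrite invr_gt0.
  have rat_near (x : R) : exists q : rat, ball (ratr q : R) (n.+1%:R^-1 : R) x.
    have [|a [bx [q _ qa]]] := dense_rat _ (ball_open x (n.+1%:R^-1 : R)).
      by exists x; exact: ballxx.
    by exists q; rewrite qa; exact: ball_sym.
  have [a ha] := rat_near p.1.1; have [b hb] := rat_near p.1.2.
  have [c hc] := rat_near p.2.
  exists (a, b, c, n) => //.
  have bp : box (a, b, c, n) p by split => //; split.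
  rewrite /F; case: asboolP => // -[]; move=> q bq; apply: eU.
  apply: (@le_ball _ _ _ (n.+1%:R^-1 + n.+1%:R^-1)).
    by rewrite [leRHS]splitr lerD// ltW.
  by apply: ball_triangle bq; exact: ball_sym.
apply: countable_bigcupT_measurable => // i.
rewrite /F; case: asboolP => // _.
rewrite (_ : box i = (ball (ratr i.1.1.1 : R) i.2.+1%:R^-1 `*`
   ball (ratr i.1.1.2 : R) i.2.+1%:R^-1) `*` ball (ratr i.1.2 : R) i.2.+1%:R^-1)//.
by apply: measurableX; [apply: measurableX|]; exact: measurable_ball.
Qed.

Lemma within_continuous_measurable3 (D : set (R * R * R)) (f : R * R * R -> R) :
  measurable D -> {within D, continuous f} -> measurable_fun D f.
Proof.
move=> mD /continuousP cf _; apply: (measurability _ (RGenOpens.measurableE R)) => //.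
move=> _ [_ [a [b ->] <-]].
have /cf/open_subspaceP[V oV e] : open `]a, b[%classic by exact: interval_open.
by rewrite setIC -[X in measurable X]e; apply: measurableI => //; exact: open_measurable3.
Qed.

End SpaceTimeMeasurability.

(** * Test functions off their support *)

Section CompactlySupported.
Context {R : realType} (T : R) (phi : R * R * R -> R) (K : set (R * R * R)).
Hypotheses (cK : compact K) (KT : K `<=` slab T)
  (phi0 : forall p, slab T p -> ~ K p -> phi p = 0).

Lemma near_off_support p : ~ K p -> \forall q \near p, ~ K q.
Proof.
move=> Kp; apply: open_nbhs_nbhs; split => //.
by apply: closed_openC; apply: compact_closed => //; exact: norm_hausdorff.
Qed.

(** The derivative in time is one-sided, so that its difference quotients stay
    in the slab, where phi vanishes off its support. *)
Lemma dt_off_support p : slab T p -> ~ K p -> dt phi p = 0.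
Proof.
case: p => X t Tp Kp; have /andP[/= t0 tT] := Tp.
have Tt : 0 < T - t by rewrite subr_gt0.
have cv : (X, t + h) @[h --> (0 : R)^'+] --> (X, t).
  apply: cvg_at_right_filter; rewrite -{2}[t]addr0.
  apply: (@cvg_pair _ _ _ _ (nbhs X) (nbhs (t + 0))); first exact: cvg_cst.
  by apply: cvgD; [exact: cvg_cst|exact: cvg_id].
apply: lim_near_cst => //; near=> h.
have h0 : 0 < h by near: h; exact: nbhs_right_gt.
rewrite /dt_quot (phi0 _ Tp Kp) subr0 phi0 ?mulr0//.
- apply/andP; split=> /=.
    by rewrite addr_ge0// ltW.
  rewrite -ltrBrDl; near: h; exact: nbhs_right_lt.
- by near: h; exact: cv _ (near_off_support _ Kp).
Unshelve. all: by end_near. Qed.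

Lemma dX_off_support p : slab T p -> ~ K p -> dX phi p = 0.
Proof.
case: p => X t Tp Kp.
suff D0 v : 'D_v (slice phi t) X = 0 by rewrite /dX /grad !D0.
have cv : (h *: v + X, t) @[h --> (0 : R)] --> (X, t).
  rewrite -{2}[X]add0r -(scale0r v).
  apply: (@cvg_pair _ _ _ _ (nbhs (0 *: v + X)) (nbhs t)); last exact: cvg_cst.
  apply: cvgD; last exact: cvg_cst.
  by apply: cvgZl; exact: cvg_id.
apply: (@derive_quadratic _ _ _ _ 0 0); near=> h.
rewrite !mulr0 !addr0 /slice (phi0 (X, t))// phi0//; near: h.
exact: cv _ (near_off_support _ Kp).
Unshelve. all: by end_near. Qed.

Lemma bounded_on_slab (V : normedModType R) (g : R * R * R -> V) :
  {within slab T, continuous g} ->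
  (forall p, slab T p -> ~ K p -> g p = 0) ->
  exists2 M, 0 <= M & forall p, slab T p -> `|g p| <= M.
Proof.
move=> cg g0.
have /compact_bounded : compact (g @` K).
  by apply: continuous_compact => //; exact: continuous_subspaceW cg.
move=> [M [_ gM]]; exists (Num.max (M + 1) 0); first by rewrite le_max lexx orbT.
move=> p Tp; have [Kp|Kp] := pselect (K p).
  by rewrite le_max (gM (M + 1)) ?ltrDl//; exists p.
by rewrite g0// normr0 le_max lexx orbT.
Qed.

(** A compact subset of the half-open slab stays away from the final time: the
    time coordinate attains its maximum on it. *)
Lemma support_before : 0 < T ->
  exists b, [/\ 0 < b, b < T & forall p, K p -> p.2 < b].
Proof.
move=> T0.
have [[p Kp]|K0] := pselect (K !=set0); last first.
  exists (T / 2); split; first by rewrite divr_gt0.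
    by rewrite ltr_pdivrMr// ltr_pMr// ltr1n.
  by move=> p Kp; exfalso; apply: K0; exists p.
have [q Kq qmax] : exists2 q, K q & forall p, K p -> p.2 <= q.2.
  have [|q Kq qmax] := compact_EVT_max (ex_intro _ p Kp) cK (_ : {within K, continuous snd}).
    by apply: continuous_subspaceT => x; exact: cvg_snd.
  by exists q; [rewrite inE in Kq|move=> r Kr; apply: qmax; rewrite inE].
have /andP[q0 qT] := KT _ Kq.
exists ((q.2 + T) / 2); split.
- by rewrite divr_gt0// ltr_wpDl.
- by lra.
- by move=> r /qmax; lra.
Qed.

End CompactlySupported.

(** * Derivatives along the characteristics *)

Section ChainRule.
Context {R : realType}.
Implicit Types phi : R * R * R -> R.

Lemma derive_space phi p (v : R * R) :
  'D_((v, 0) : R * R * R) phi p = 'D_v (slice phi p.2) p.1.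
Proof.
case: p => X t; rewrite /derive.
rewrite (_ : (fun h => _) = (fun h : R =>
    h^-1 *: ((slice phi t \o shift X) (h *: v) - slice phi t X)))//.
apply/funext => h /=; congr (_ *: (phi _ - _)).
by congr (_, _); rewrite /= scaler0 add0r.
Qed.

(** The one-sided time derivative agrees with the directional one wherever phi
    is differentiable, which gives access to the chain rule. *)
Lemma derive_time phi p : differentiable phi p ->
  'D_((0, 1) : R * R * R) phi p = dt phi p.
Proof.
move=> /diff_derivable dphi; have := dphi ((0, 1) : R * R * R).
rewrite /derivable /derive /dt (_ : (fun h : R =>
    h^-1 *: ((phi \o shift p) (h *: ((0, 1) : R * R * R)) - phi p)) = dt_quot phi p).
  exact: cvg_at_rightE.
case: p {dphi} => X t; apply/funext => h /=; rewrite /dt_quot.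
congr (_ * (phi _ - _)).
by congr (_, _); rewrite /= ?scaler0 ?add0r// /GRing.scale/= mulr1 addrC.
Qed.

Lemma is_derive_along_curve phi (x y : R -> R) (t dx dy : R) :
  differentiable phi ((x t, y t), t) ->
  is_derive t 1 x dx -> is_derive t 1 y dy ->
  is_derive t 1 (fun s => phi ((x s, y s), s))
    (dt phi ((x t, y t), t) + dot (dx, dy) (dX phi ((x t, y t), t))).
Proof.
move=> dphi x't y't.
have dfx : differentiable x t by apply/derivable1_diffP; exact: ex_derive.
have dfy : differentiable y t by apply/derivable1_diffP; exact: ex_derive.
pose g (s : R) : R * R * R := ((x s, y s), s).
have dg : differentiable g t by do 2 apply: differentiable_pair => //.
apply: DeriveDef.
  apply: diff_derivable; exact: (differentiable_comp dg).
rewrite deriveE; last exact: (differentiable_comp dg).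
rewrite (_ : (fun s => _) = phi \o g)// diff_comp//=.
have -> : 'd g t 1 = dx *: ((1, 0), 0) + (dy *: ((0, 1), 0) + ((0, 0), 1)) :> R * R * R.
  rewrite /g diff_pair//; last exact: differentiable_pair.
  rewrite diff_pair// -!deriveE// !derive_val/=.
  by apply: injective_projections; [apply: injective_projections|];
    rewrite /= /GRing.scale/=; ring.
rewrite !linearD !linearZ/= -!deriveE//.
rewrite derive_time// !derive_space /dot /dX /grad/=.
rewrite /GRing.scale/=; ring.
Qed.

End ChainRule.

Section Trajectories.
Context {R : realType} (eps : R) (eps_gt0 : 0 < eps).

(** The velocity X |-> (X - grad P*(X))^perp, for the value (X - z)/eps that
    grad P* takes on the disk of centre z and radius eps, extended to the whole
    plane by the same formula. *)
Definition drift (X z : R * R) : R * R := perp (X - eps^-1 *: (X - z)).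

(** With W = X - z(t) = eps R(ct) Y, the characteristic has derivative
    z^perp + c W^perp, which is (X - W/eps)^perp because c = 1 - 1/eps. *)
Lemma is_derive_trajectory1 Y t :
  is_derive t (1 : R) (fun s => (trajectory eps s Y).1)
    (drift (trajectory eps t Y) (orbit_center t)).1.
Proof.
rewrite /trajectory /similarity/=; apply: is_derive_eq.
rewrite /drift /perp /similarity /spin /= /GRing.scale/=; field.
by rewrite gt_eqF.
Qed.

Lemma is_derive_trajectory2 Y t :
  is_derive t (1 : R) (fun s => (trajectory eps s Y).2)
    (drift (trajectory eps t Y) (orbit_center t)).2.
Proof.
rewrite /trajectory /similarity/=; apply: is_derive_eq.
rewrite /drift /perp /similarity /spin /= /GRing.scale/=; field.
by rewrite gt_eqF.
Qed.

End Trajectories.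

Lemma within_continuous_comp_maps {U V W : topologicalType} (A : set U) (B : set V)
    (f : U -> V) (g : V -> W) :
  continuous f -> (forall x, A x -> B (f x)) ->
  {within B, continuous g} -> {within A, continuous (g \o f)}.
Proof.
move=> cf AB /subspace_continuousP cg; apply/subspace_continuousP => x Ax N gN.
have := cf x _ (cg (f x) (AB x Ax) N gN); rewrite /= /nbhs/=.
by apply: filterS => y BN Ay; exact: BN (AB _ Ay).
Qed.

Section AlongTrajectories.
Context {R : realType} (eps : R) (eps_gt0 : 0 < eps).

Definition material_derivative (phi : R * R * R -> R) (p : R * R * R) : R :=
  dt phi p + dot (drift eps p.1 (orbit_center p.2)) (dX phi p).

Lemma continuous_flow Y : continuous (fun t => flow eps (Y, t)).
Proof.
move=> t; apply: differentiable_continuous.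
have d1 : differentiable (fun s => (trajectory eps s Y).1) t.
  by apply/derivable1_diffP; case: (is_derive_trajectory1 _ eps_gt0 Y t).
have d2 : differentiable (fun s => (trajectory eps s Y).2) t.
  by apply/derivable1_diffP; case: (is_derive_trajectory2 _ eps_gt0 Y t).
rewrite (_ : (fun _ => _) = fun s => (((trajectory eps s Y).1, (trajectory eps s Y).2), s)).
  by do 2 apply: differentiable_pair => //.
by apply/funext => s; rewrite /flow -surjective_pairing.
Qed.

Lemma continuous_drift Y :
  continuous (fun t => (drift eps (trajectory eps t Y) (orbit_center t)).1) /\
  continuous (fun t => (drift eps (trajectory eps t Y) (orbit_center t)).2).
Proof.
by split=> t; apply: differentiable_continuous; apply/derivable1_diffP;
  rewrite /drift /perp /trajectory /similarity /orbit_center/=; apply: ex_derive.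
Qed.

Lemma flow_in_slab (T b : R) Y t : b < T ->
  `[0, b]%classic t -> slab T (flow eps (Y, t)).
Proof.
by move=> bT; rewrite /= in_itv/= /slab/= => /andP[-> tb]; rewrite (le_lt_trans tb).
Qed.

Lemma continuous_material_derivative (T b : R) (phi : R * R * R -> R) Y :
  C1_slab T phi -> b < T ->
  {within `[0, b], continuous (fun t => material_derivative phi (flow eps (Y, t)))}.
Proof.
move=> [_ _ _ cdt cdX] bT; have in_slab t := flow_in_slab T b Y t bT.
have [cd1 cd2] := continuous_drift Y.
have cdt' := within_continuous_comp_maps _ _ _ _ (continuous_flow Y) in_slab cdt.
have cdX' := within_continuous_comp_maps _ _ _ _ (continuous_flow Y) in_slab cdX.
have cdX1 : {within `[0, b], continuous (fun t => (dX phi (flow eps (Y, t))).1)}.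
  by move=> t; apply: (cvg_comp _ fst (cdX' t)); exact: cvg_fst.
have cdX2 : {within `[0, b], continuous (fun t => (dX phi (flow eps (Y, t))).2)}.
  by move=> t; apply: (cvg_comp _ snd (cdX' t)); exact: cvg_snd.
move=> t; rewrite /material_derivative /dot.
apply: cvgD; first exact: cdt'.
apply: cvgD; apply: cvgM.
- exact: (continuous_subspaceT cd1).
- exact: cdX1.
- exact: (continuous_subspaceT cd2).
- exact: cdX2.
Qed.

(** The fundamental theorem of calculus on [0, b]: phi is differentiable only at
    positive times, but it and its derivatives are continuous down to time 0. *)
Lemma integral_material_derivative (T b : R) (phi : R * R * R -> R) Y :
  C1_slab T phi -> 0 < b -> b < T ->
  (\int[lebesgue_measure]_(t in `[0%R, b]) (material_derivative phi (flow eps (Y, t)))%:E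
   = (phi (flow eps (Y, b)))%:E - (phi (flow eps (Y, 0%R)))%:E)%E.
Proof.
move=> C1phi b0 bT; have [cphi dphi _ _ _] := C1phi.
have in_slab t := flow_in_slab T b Y t bT.
have cF : {within `[0, b], continuous (fun t => phi (flow eps (Y, t)))}.
  exact: within_continuous_comp_maps (continuous_flow Y) in_slab cphi.
have [_ F0 Fb] := (continuous_within_itvP _ b0).1 cF.
have dF t : t \in `]0, b[ -> is_derive t (1 : R) (fun t => phi (flow eps (Y, t)))
    (material_derivative phi (flow eps (Y, t))).
  rewrite in_itv/= => /andP[t0 tb].
  have := @is_derive_along_curve _ phi (fun s => (trajectory eps s Y).1)
    (fun s => (trajectory eps s Y).2) t _ _ _
    (is_derive_trajectory1 _ eps_gt0 Y t) (is_derive_trajectory2 _ eps_gt0 Y t).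
  under eq_fun do rewrite -surjective_pairing.
  rewrite -!surjective_pairing; apply.
  by apply: dphi; rewrite /= t0 (lt_trans tb).
apply: (@continuous_FTC2 _ (fun t => material_derivative phi (flow eps (Y, t)))
  (fun t => phi (flow eps (Y, t)))) => //.
- exact: continuous_material_derivative C1phi bT.
- by split=> // t /dF[].
- by move=> t /dF ?; rewrite derive1E derive_val.
Qed.

End AlongTrajectories.

(** * The weak formulation *)

Lemma integrable_bounded_support d (T : measurableType d) (R : realType)
    (mu : {measure set T -> \bar R}) (D E : set T) (f : T -> R) (M : R) :
  measurable D -> measurable E -> (mu E < +oo)%E -> measurable_fun D f ->
  (forall x, D x -> ~ E x -> f x = 0) -> (forall x, D x -> `|f x| <= M) ->
  mu.-integrable D (EFin \o f).
Proof.
move=> mD mE muE mf f0 fM.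
have : mu.-integrable (D `&` E) (EFin \o f).
  apply: measurable_bounded_integrable.
  - exact: measurableI.
  - by apply: le_lt_trans muE; apply: le_measure; rewrite ?inE//; exact: measurableI.
  - by apply: measurable_funS mf => // x [].
  - exists M; split; first exact: num_real.
    by move=> N MN x [/fM fxM _]; exact: le_trans fxM (ltW MN).
move=> /(integrable_restrict _ mE mD); apply: eq_integrable => // x.
rewrite inE => Dx; rewrite patchE; case: ifPn => //.
by rewrite notin_setE => Ex; rewrite /= f0.
Qed.

Section DiskSolution.
Context {R : realType} (eps : R) (eps_gt0 : 0 < eps).

Let pressure (t : R) : R * R -> R := potential eps (orbit_center t).
Let dual_velocity := velocity (disk (0, 0) 1) pressure.

(** The velocity is known explicitly on the disk that carries the potential
    vorticity; elsewhere both sides vanish, whatever the velocity is. *)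
Lemma weak_integrandE (phi : R * R * R -> R) p :
  weak_integrand dual_velocity (alpha_disk eps) phi p
  = material_derivative eps phi p * alpha_disk eps p.2 p.1.
Proof.
rewrite /weak_integrand /alpha_disk indicE.
have [Dp|] := boolP (p.1 \in _); last by rewrite !mulr0.
rewrite /material_derivative /dual_velocity /velocity grad_legendre_potential//.
by rewrite inE in Dp.
Qed.

(** All the moving disks lie in this square, which bounds the support of the
    integrands uniformly in time. *)
Let box : set (R * R) :=
  `[- (1 + eps), 1 + eps]%classic `*` `[- (1 + eps), 1 + eps]%classic.

Lemma measurable_box : measurable box.
Proof. by apply: measurableX; exact: measurable_itv. Qed.

Lemma leb2_box_fin : (leb2 box < +oo)%E.
Proof.
have lt_pinfty := lebesgue_measure_segment_fin (- (1 + eps)) (1 + eps).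
rewrite product_measure1E; [|exact: measurable_itv|exact: measurable_itv].
by apply: lte_mul_pinfty; rewrite // ge0_fin_numE.
Qed.

Lemma disk_coord_lt (z X : R * R) (r : R) : 0 < r -> disk z r X ->
  `|X.1 - z.1| < r /\ `|X.2 - z.2| < r.
Proof.
move=> r0; rewrite diskE//= /dot/= => DX.
by split; rewrite -(@ltr_pXn2r _ 2) ?nnegrE// ?ltW// real_normK ?num_real//;
  rewrite (le_lt_trans _ DX)// expr2 ?lerDl ?lerDr -expr2 sqr_ge0.
Qed.

Lemma disk_orbit_coord_le t X : disk (orbit_center t) eps X ->
  `|X.1| <= 1 + eps /\ `|X.2| <= 1 + eps.
Proof.
move=> /(disk_coord_lt _ _ _ eps_gt0)[]; rewrite /orbit_center/= => d1 d2.
have le_bound x c : `|x - c| < eps -> `|c| <= 1 -> `|x| <= 1 + eps.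
  move=> xc c1; rewrite -(subrK c x) (le_trans (ler_normD _ _))// addrC.
  by rewrite lerD// ltW.
by split; [exact: le_bound (cos_max t)|exact: le_bound (sin_max t)].
Qed.

Lemma disk_sub_box t X : disk (orbit_center t) eps X -> box X.
Proof.
move=> /disk_orbit_coord_le[X1 X2].
by split; rewrite /= in_itv/= -ler_norml.
Qed.

Lemma alpha_disk_ge0 t X : 0 <= alpha_disk eps t X.
Proof. by rewrite mulr_ge0// invr_ge0 sqr_ge0. Qed.

Lemma alpha_disk_le t X : alpha_disk eps t X <= (eps ^+ 2)^-1.
Proof.
by rewrite ler_piMr ?invr_ge0 ?sqr_ge0// indicE; case: (_ \in _).
Qed.

Lemma alpha_disk_off t X : ~ box X -> alpha_disk eps t X = 0.
Proof.
move=> BX; rewrite /alpha_disk indicE memNset ?mulr0//.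
by move=> /disk_sub_box.
Qed.

(** Every trajectory map pulls the moving disk back to the unit disk, so that in
    the labels Y the potential vorticity does not depend on time. *)
Lemma alpha_disk_trajectory t Y :
  alpha_disk eps t (trajectory eps t Y) = (eps ^+ 2)^-1 * \1_(disk (0, 0) 1) Y.
Proof.
rewrite /alpha_disk -(disk_similarity eps _ _ (orbit_center t) eps_gt0 (spin_radius eps t)).
by [].
Qed.

Lemma measurable_orbit_center :
  measurable_fun setT (fun p : R * R * R => cos p.2) /\
  measurable_fun setT (fun p : R * R * R => sin p.2).
Proof.
split; (apply: measurableT_comp; last exact: measurable_snd);
  apply: continuous_measurable_fun; [exact: continuous_cos|exact: continuous_sin].
Qed.

Lemma measurable_alpha_disk :
  measurable_fun setT (fun p : R * R * R => alpha_disk eps p.2 p.1).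
Proof.
have -> : (fun p : R * R * R => alpha_disk eps p.2 p.1)
   = (fun p => (eps ^+ 2)^-1 * \1_[set p : R * R * R | disk (orbit_center p.2) eps p.1] p).
  by apply/funext => p; rewrite /alpha_disk !indicE.
apply: measurable_funM => //; apply: measurable_indic.
rewrite -[X in measurable X]setTI.
rewrite (_ : [set p | _] = [set p : R * R * R |
   (p.1.1 - cos p.2) * (p.1.1 - cos p.2) + (p.1.2 - sin p.2) * (p.1.2 - sin p.2) < eps ^+ 2]).
  have [mc ms] := measurable_orbit_center.
  have m1 : measurable_fun setT (fun p : R * R * R => p.1.1) by exact: measurableT_comp.
  have m2 : measurable_fun setT (fun p : R * R * R => p.1.2) by exact: measurableT_comp.
  apply: measurable_fun_ltr => //=.
  by apply: measurable_funD; apply: measurable_funM; exact: measurable_funB.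
by apply/funext => p; rewrite -[LHS]/(disk (orbit_center p.2) eps p.1) diskE.
Qed.

Section TestFunction.
Variables (T : R) (T_gt0 : 0 < T) (phi : R * R * R -> R) (K : set (R * R * R)).
Hypotheses (C1phi : C1_slab T phi) (cK : compact K) (KT : K `<=` slab T)
  (phi0 : forall p, slab T p -> ~ K p -> phi p = 0).

Let integrand := weak_integrand dual_velocity (alpha_disk eps) phi.
Let initial_term X := alpha_disk eps 0 X * phi (X, 0).

Lemma measurable_slab : measurable (slab T : set (R * R * R)).
Proof.
rewrite (_ : slab T = setT `*` `[0, T[%classic); last first.
  by apply/seteqP; split=> p; rewrite /slab /= in_itv/=; [split|case].
by apply: measurableX => //; exact: measurable_itv.
Qed.

Lemma measurable_integrand : measurable_fun (slab T) integrand.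
Proof.
have [_ _ _ cdt cdX] := C1phi.
rewrite (_ : integrand =
    fun p => material_derivative eps phi p * alpha_disk eps p.2 p.1); last first.
  by apply/funext => p; exact: weak_integrandE.
have mslice (g : R * R * R -> R) : {within slab T, continuous g} ->
    measurable_fun (slab T) g.
  by apply: within_continuous_measurable3; exact: measurable_slab.
have [mc ms] := measurable_orbit_center.
have m1 : measurable_fun setT (fun p : R * R * R => p.1.1) by exact: measurableT_comp.
have m2 : measurable_fun setT (fun p : R * R * R => p.1.2) by exact: measurableT_comp.
apply: measurable_funM; last by apply: measurable_funTS; exact: measurable_alpha_disk.
apply: measurable_funD; first exact: mslice.
apply: measurable_funD; apply: measurable_funM.
- apply: measurable_funTS; apply: measurable_funN; apply: measurable_funB => //.
  by apply: measurable_funM => //; exact: measurable_funB.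
- by apply: mslice => p; apply: (cvg_comp _ fst (cdX p)); exact: cvg_fst.
- apply: measurable_funTS; apply: measurable_funB => //.
  by apply: measurable_funM => //; exact: measurable_funB.
- by apply: mslice => p; apply: (cvg_comp _ snd (cdX p)); exact: cvg_snd.
Qed.

Lemma integrable_integrand : leb3.-integrable (slab T) (EFin \o integrand).
Proof.
have [_ _ _ cdt cdX] := C1phi.
have [M1 M1_ge0 dtM] := bounded_on_slab T K cK KT _ _ cdt (dt_off_support T phi K cK phi0).
have [M2 M2_ge0 dXM] := bounded_on_slab T K cK KT _ _ cdX (dX_off_support T phi K cK phi0).
(* On the moving disk, |X_i| <= 1 + eps and |X_i - z_i|/eps <= 1, so that both
   components of the drift are at most 2 + eps. *)
pose C := (M1 + 2 * ((2 + eps) * M2)) * (eps ^+ 2)^-1.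
apply: (@integrable_bounded_support _
    (measurableTypeR R * measurableTypeR R * measurableTypeR R)%type R
    leb3 (slab T) (box `*` `[0, T]%classic) integrand C).
- exact: measurable_slab.
- by apply: measurableX; [exact: measurable_box|exact: measurable_itv].
- have lt_pinfty := lebesgue_measure_segment_fin 0 T.
  rewrite [ltLHS](_ : _ = leb2 box * lebesgue_measure (`[0%R, T]%classic : set R))%E; last first.
    exact: (@product_measure1E _ _ _ _ R leb2 lebesgue_measure box `[0, T]%classic
      measurable_box (measurable_itv _)).
  by apply: lte_mul_pinfty; rewrite // ge0_fin_numE// leb2_box_fin.
- exact: measurable_integrand.
- move=> p Tp Bp; rewrite /integrand weak_integrandE alpha_disk_off ?mulr0// => B1.
  apply: Bp; split => //=; rewrite in_itv/=.
  by move: Tp => /andP[-> /ltW].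
- move=> p Tp; rewrite /integrand weak_integrandE normrM (ger0_norm (alpha_disk_ge0 _ _)).
  have [Dp|Dp] := pselect (disk (orbit_center p.2) eps p.1); last first.
    rewrite /alpha_disk indicE memNset// !mulr0.
    by rewrite mulr_ge0 ?invr_ge0 ?sqr_ge0// addr_ge0// mulr_ge0// mulr_ge0// addr_ge0// ltW.
  apply: ler_pM => //; [exact: alpha_disk_ge0| |exact: alpha_disk_le].
  have [X1 X2] := disk_orbit_coord_le _ _ Dp.
  have [W1 W2] := disk_coord_lt _ _ _ eps_gt0 Dp.
  have W_le (w : R) : `|w| < eps -> `|eps^-1 * w| <= 1.
    by move=> w_lt; rewrite normrM gtr0_norm ?invr_gt0// ler_pdivrMl// mulr1 ltW.
  have drift_le (x w : R) : `|x| <= 1 + eps -> `|w| < eps -> `|x - eps^-1 * w| <= 2 + eps.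
    move=> x_le /W_le w_le; rewrite (le_trans (ler_normB _ _))//.
    by rewrite (_ : 2 + eps = (1 + eps) + 1) ?lerD//; ring.
  have [D1 D2] : `|(dX phi p).1| <= M2 /\ `|(dX phi p).2| <= M2.
    have := dXM p Tp; rewrite prod_normE ge_max => /andP[]; by split.
  rewrite /material_derivative (le_trans (ler_normD _ _))// lerD ?dtM//.
  rewrite /dot (le_trans (ler_normD _ _))// mulr_natl mulr2n !normrM.
  by apply: lerD; apply: ler_pM => //; rewrite ?normrN; exact: drift_le.
Qed.

Lemma integrable_initial_term : leb2.-integrable setT (EFin \o initial_term).
Proof.
have [cphi _ _ _ _] := C1phi.
have [M M_ge0 phiM] := bounded_on_slab T K cK KT _ _ cphi phi0.
have in_slab X : slab T (X, 0) by rewrite /slab/= lexx.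
apply: (@integrable_bounded_support _ (measurableTypeR R * measurableTypeR R)%type R
    leb2 setT box initial_term ((eps ^+ 2)^-1 * M)).
- exact: measurableT.
- exact: measurable_box.
- exact: leb2_box_fin.
- apply: measurable_funM.
    exact: (measurableT_comp measurable_alpha_disk (pair2_measurable (0 : R))).
  apply: (@measurable_comp _ _ _ _ _ _ (slab T) phi setT (fun X : R * R => (X, 0)));
    [exact: measurable_slab| | |exact: pair2_measurable].
    by move=> _ [X _ <-]; exact: in_slab.
  by apply: within_continuous_measurable3 => //; exact: measurable_slab.
- by move=> X _ BX; rewrite /initial_term alpha_disk_off// mul0r.
- move=> X _; rewrite /initial_term normrM (ger0_norm (alpha_disk_ge0 _ _)).
  by apply: ler_pM => //; [exact: alpha_disk_ge0|exact: alpha_disk_le|exact: phiM].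
Qed.

(** Extended by zero, so that the change of variables, stated on the whole of
    space-time, and Fubini's theorem apply. *)
Let integrand_ext : R * R * R -> \bar R := (EFin \o integrand) \_ (slab T).

(** Along a characteristic the potential vorticity is the constant a, and the
    integral of the derivative of phi over time leaves only the value at
    time 0. *)
Lemma integral_integrand_trajectory Y :
  (\int[lebesgue_measure]_(t in [set: R]) integrand_ext (flow eps (Y, t))
   = (- initial_term (trajectory eps 0%R Y))%:E)%E.
Proof.
have [b [b0 bT Kb]] := support_before T K cK KT T_gt0.
have off t : b <= t -> t < T -> slab T (flow eps (Y, t)) /\ ~ K (flow eps (Y, t)).
  move=> bt tT; split; first by rewrite /slab/= tT (le_trans (ltW b0)).
  by move=> /Kb; rewrite /= ltNge bt.
pose a := (eps ^+ 2)^-1 * \1_(disk (0, 0) 1) Y.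
(* Stopping at a time b after the support of phi gives a compact interval, on
   which the derivative is continuous. *)
transitivity (\int[lebesgue_measure]_(t in `[0%R, b])
    (a%:E * (material_derivative eps phi (flow eps (Y, t)))%:E))%E.
  rewrite [RHS]integral_mkcond; apply: eq_integral => t _.
  rewrite /integrand_ext !patchE.
  have [tb|tb] := boolP (t \in `[0, b]%classic).
    rewrite mem_set; last by rewrite inE in tb; exact: flow_in_slab bT tb.
    by rewrite /= /integrand weak_integrandE alpha_disk_trajectory -EFinM mulrC.
  case: ifPn => //; rewrite inE /slab/= => /andP[t0 tT].
  have [|Ts Ko] := off t _ tT.
    by move: tb; rewrite notin_setE /= in_itv/= t0/= => /negP; rewrite -ltNge => /ltW.
  rewrite /integrand weak_integrandE /material_derivative.
  rewrite (dt_off_support T phi K cK phi0)// (dX_off_support T phi K cK phi0)//.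
  by rewrite /dot/= !mulr0 !addr0 mul0r.
rewrite integralZl//; last first.
  apply: continuous_compact_integrable; first exact: segment_compact.
  exact: continuous_material_derivative C1phi bT.
rewrite (integral_material_derivative _ eps_gt0 T)//.
have [Ts Ko] := off b (lexx b) bT.
rewrite (phi0 _ Ts Ko) sub0e -EFinN -EFinM mulrN; congr (- _)%:E.
by rewrite /initial_term alpha_disk_trajectory.
Qed.

(** Both the space-time integral and the one at time 0 acquire the same factor
    1/eps^2 when written in the labels Y, where they are opposite. *)
Lemma weak_formulation :
  (\int[leb3]_(p in slab T) (integrand p)%:E + \int[leb2]_(X in setT) (initial_term X)%:E = 0)%E.
Proof.
have k_gt0 : 0 < (eps ^+ 2)^-1 by rewrite invr_gt0 exprn_gt0.
have iF : (plane_measure \x lebesgue_measure)%E.-integrable setT integrand_ext.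
  exact: (@integrable_mkcond _ _ _ (plane_measure \x lebesgue_measure)%E
    (slab T) (EFin \o integrand) measurable_slab).1 integrable_integrand.
have mflow := measurable_flow eps.
pose mu3 : {measure set (measurableTypeR R * measurableTypeR R * measurableTypeR R) -> \bar R} :=
  (plane_measure \x lebesgue_measure)%E.
have iFflow : mu3.-integrable setT (integrand_ext \o flow eps).
  exact: (@integrable_scaling _ _ R mu3 _ _ mflow k_gt0 (leb3_flow eps eps_gt0) _ iF).
have scaleF : (\int[mu3]_q integrand_ext (flow eps q)
    = (eps ^+ 2)^-1%:E * \int[mu3]_q integrand_ext q)%E.
  exact: (@integral_scaling _ _ R mu3 _ _ mflow k_gt0 (leb3_flow eps eps_gt0) _ iF).
have scaleF0 : (\int[leb2]_Y (initial_term (trajectory eps 0%R Y))%:E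
    = (eps ^+ 2)^-1%:E * \int[leb2]_Y (initial_term Y)%:E)%E.
  exact: (@integral_scaling _ (measurableTypeR R * measurableTypeR R)%type R leb2 _ _
    (measurable_trajectory eps 0) k_gt0 (leb2_trajectory eps eps_gt0 0) _ integrable_initial_term).
have fubiniF : (\int[mu3]_q integrand_ext (flow eps q) =
    \int[leb2]_Y (- initial_term (trajectory eps 0%R Y))%:E)%E.
  rewrite -(integral12_prod_meas1 iFflow); apply: eq_integral => Y _.
  exact: integral_integrand_trajectory.
have iF0traj : leb2.-integrable setT (EFin \o (initial_term \o trajectory eps 0)).
  exact: (@integrable_scaling _ (measurableTypeR R * measurableTypeR R)%type R leb2 _ _
    (measurable_trajectory eps 0) k_gt0 (leb2_trajectory eps eps_gt0 0) _ integrable_initial_term).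
have sumE : ((eps ^+ 2)^-1%:E * \int[mu3]_q integrand_ext q
    = - ((eps ^+ 2)^-1%:E * \int[leb2]_Y (initial_term Y)%:E))%E.
  rewrite -scaleF fubiniF -scaleF0 -integralN//.
  by apply: fin_num_adde_defr; exact: integrable_pos_fin_num iF0traj.
have /fineK F3E : (\int[mu3]_q integrand_ext q)%E \is a fin_num by exact: integrable_fin_num iF.
have /fineK F0E : (\int[leb2]_Y (initial_term Y)%:E)%E \is a fin_num.
  exact: integrable_fin_num integrable_initial_term.
move: sumE; rewrite -F3E -F0E -!EFinM -EFinN => -[] sumE.
rewrite [X in (X + _)%E](_ : _ = \int[mu3]_q integrand_ext q)%E; last exact: integral_mkcond.
rewrite -F3E -[in RHS]/(0%:E) -EFinD; congr EFin.
apply: (mulfI (lt0r_neq0 k_gt0)).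
by rewrite mulr0 mulrDr sumE addNr.
Qed.

End TestFunction.

End DiskSolution.

Theorem proposition5p1 (R : realType) (eps : R) (heps : 0 < eps) :
  weak_solution (disk (0, 0) 1) (alpha_disk eps) (alpha_disk eps 0).
Proof.
exists (fun t => potential eps (orbit_center t)); split=> [t _|T phi T_gt0].
  by split; [exact: convex_potential|exact: pushes_to_potential].
move=> [C1phi [K [cK KT phi0]]]; split.
- exact: (integrable_integrand _ heps T phi K C1phi cK KT phi0).
- exact: (integrable_initial_term _ heps T T_gt0 phi K C1phi cK KT phi0).
- exact: (weak_formulation _ heps T T_gt0 phi K C1phi cK KT phi0).
Qed.
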